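(* Let $\mathbf{G}(s)$ be a minimal SISO transfer function and let $p_i\in\mathbb{C}$ be a simple pole of $\mathbf{G}$. Suppose $$\mathbf{G}(s)=\frac{s-q_i}{s-p_i}\,\frac{n(s)}{d(s)},$$ where $q_i\in\mathbb{C}$ and $n,d$ are complex polynomials such that $n(s)$ is coprime to $d(s)$ and to $s-p_i$, and $d(s)$ is coprime to $s-p_i$. Let $a(s),b(s)$ be polynomials with $a(s)d(s)+b(s)(s-p_i)=1$, where $a(s)$ is a constant and $\deg b<\deg d$ (these exist by Bezout's identity), and write $n(s)a(s)=f(s)(s-p_i)+\rho$ with $f$ a complex polynomial and remainder $\rho\in\mathbb{C}$. Then $$\mathbf{G}(s)=\frac{(p_i-q_i)\,\rho}{s-p_i}+\frac{e(s)}{d(s)},$$ where $e(s)=n(s)(s-q_i)b(s)+n(s)a(s)d(s)+(p_i-q_i)f(s)d(s)$.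
   Context: A SISO transfer function is a scalar real-rational function of the complex variable $s$; minimal means it is written without common factors between numerator and denominator. The zero polynomial has degree $-\infty$. *)

(* Defs.v *)
From mathcomp Require Import all_boot all_order all_algebra.
From mathcomp Require Import reals.
From mathcomp Require Export complex.

Set Implicit Arguments.
Unset Strict Implicit.
Unset Printing Implicit Defensive.

Import Order.TTheory GRing.Theory Num.Theory.

Local Open Scope ring_scope.

(* A scalar real-rational function of s; it is not assumed to be proper. *)
Record siso_tf (R : realType) := SisoTf {
  tf_num : {poly R};
  tf_den : {poly R};
  tf_den_neq0 : tf_den != 0
}.

Definition minimal (R : realType) (G : siso_tf R) : bool :=
  coprimep (tf_num G) (tf_den G).

Notation complexify p := (map_poly (real_complex _) p).

(* u / v as an element of C(s). A zero denominator would give the junk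
   value 0. *)
Definition ratfun (R : realType) (u v : {poly R[i]}) : {fraction {poly R[i]}} :=
  tofrac u / tofrac v.

(* G(s) as an element of C(s). *)
Definition tf_fun (R : realType) (G : siso_tf R) : {fraction {poly R[i]}} :=
  ratfun (complexify (tf_num G)) (complexify (tf_den G)).

(* The poles of a minimal transfer function, with their multiplicities, are the
   roots of its denominator; this definition is meant for minimal G only. *)
Definition simple_pole (R : realType) (G : siso_tf R) (p : R[i]) : Prop :=
  mup p (complexify (tf_den G)) = 1%N.

(* Since size 0 = 0 and size u = deg u + 1 otherwise, size b < size d is
   deg b < deg d with deg 0 = -oo, and size a <= 1 says that a is a constant. *)
Definition bezout_pair (R : realType) (p : R[i]) (d a b : {poly R[i]}) : Prop :=
  [/\ a * d + b * ('X - p%:P) = 1, (size a <= 1)%N & (size b < size d)%N].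

(* Main.v *)
Require Import Defs.
From mathcomp Require Import all_boot all_order all_algebra.
From mathcomp Require Import reals.
From mathcomp Require Import ring.

Set Implicit Arguments.
Unset Strict Implicit.
Unset Printing Implicit Defensive.

Import Order.TTheory GRing.Theory Num.Theory.

Local Open Scope ring_scope.

(** Write [l = 'X - p].  After multiplication by [l * d], the decomposition is
    the polynomial identity [('X - q) * n = (p - q) * rho * d + e * l]
    ([residue_numerator]).  To see it, split [('X - q) * n] with the Bezout
    relation [a * d + b * l = 1]: the summand [('X - q) * n * b * l] is already
    a multiple of [l], and in the other one, [('X - q) * n * a * d], replacing
    ['X - q] by [l + (p - q)] leaves only [(p - q) * (n * a) * d] to be reduced
    modulo [l]; this is done by the division [n * a = f * l + rho].

    For the Bezout pair, the remainder of [d] modulo [l] is the constant [d.[p]],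
    which is nonzero by coprimality, so one step of Euclid's algorithm is
    enough ([bezout_XsubC]).  The quotient [d %/ l] has smaller degree than
    [d], which gives the degree bound on [b]. *)

Lemma divp_XsubC (F : fieldType) (u : {poly F}) (p : F) :
  u = u %/ ('X - p%:P) * ('X - p%:P) + u.[p]%:P.
Proof. by rewrite {1}(divp_eq u ('X - p%:P)) modp_XsubC. Qed.

Lemma bezout_XsubC (F : fieldType) (d : {poly F}) (p : F) :
    d.[p] != 0 ->
  exists a b : {poly F},
    [/\ a * d + b * ('X - p%:P) = 1, (size a <= 1)%N & (size b < size d)%N].
Proof.
move=> dp_neq0; exists (d.[p]^-1)%:P, (- (d.[p]^-1 *: (d %/ ('X - p%:P)))).
split; last 1 first.
- have d_neq0 : d != 0.
    by apply: contraNneq dp_neq0 => ->; rewrite horner0.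
  rewrite size_polyN size_scale ?invr_eq0 // size_divp ?polyXsubC_eq0 //.
  (* The size of d is positive, so the subtraction of 1 is not truncated. *)
  by rewrite size_XsubC subn1 prednK ?size_poly_gt0.
- rewrite mul_polyC {2}(divp_XsubC d p) scalerDr mulNr -scalerAl addrAC subrr.
  by rewrite add0r -mul_polyC -polyCM mulVf.
- by rewrite size_polyC leq_b1.
Qed.

Lemma residue_numerator (A : comNzRingType) (p q rho : A)
    (n d a b f : {poly A}) :
    a * d + b * ('X - p%:P) = 1 ->
    n * a = f * ('X - p%:P) + rho%:P ->
  ('X - q%:P) * n =
    ((p - q) * rho)%:P * d
    + (n * ('X - q%:P) * b + n * a * d + (p - q) *: (f * d)) * ('X - p%:P).
Proof.
move=> bezout division.
have rhoE : rho%:P = n * a - f * ('X - p%:P) by rewrite division addrC addKr.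
(* Once 1 is expanded on the left and rho is eliminated on the right, both
   relations are used up and an identity between free variables remains. *)
rewrite -[LHS]mulr1 -bezout -mul_polyC polyCM polyCB rhoE.
ring.
Qed.

Lemma ratfun_add (R : realType) (u v w z : {poly R[i]}) :
    v != 0 -> z != 0 ->
  ratfun u v + ratfun w z = ratfun (u * z + w * v) (v * z).
Proof.
move=> v_neq0 z_neq0; rewrite /ratfun addf_div ?tofrac_eq0 //.
by rewrite tofracD !tofracM.
Qed.

Lemma ratfun_mul (R : realType) (u v w z : {poly R[i]}) :
  ratfun u v * ratfun w z = ratfun (u * w) (v * z).
Proof. by rewrite /ratfun mulf_div !tofracM. Qed.

Theorem lemma5 (R : realType) (G : siso_tf R) (p q : R[i]) (n d : {poly R[i]})
    (hmin : minimal G)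
    (hpole : simple_pole G p)
    (hG : tf_fun G = ratfun ('X - q%:P) ('X - p%:P) * ratfun n d)
    (hnd : coprimep n d)
    (hnp : coprimep n ('X - p%:P))
    (hdp : coprimep d ('X - p%:P)) :
  (exists a b : {poly R[i]}, bezout_pair p d a b) /\
  (forall a b : {poly R[i]}, bezout_pair p d a b ->
    (exists (f : {poly R[i]}) (rho : R[i]),
      n * a = f * ('X - p%:P) + rho%:P) /\
    (forall (f : {poly R[i]}) (rho : R[i]),
      n * a = f * ('X - p%:P) + rho%:P ->
      let e := n * ('X - q%:P) * b + n * a * d + (p - q) *: (f * d) in
      tf_fun G = ratfun ((p - q) * rho)%:P ('X - p%:P) + ratfun e d)).
Proof.
have dp_neq0 : d.[p] != 0 by rewrite -rootE -coprimep_XsubC.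
split; first exact: bezout_XsubC.
move=> a b [bezout _ size_b]; split.
  by exists ((n * a) %/ ('X - p%:P)), (n * a).[p]; apply: divp_XsubC.
move=> f rho division e.
have d_neq0 : d != 0 by rewrite -size_poly_gt0 (leq_trans _ size_b).
rewrite hG ratfun_mul ratfun_add ?polyXsubC_eq0 //.
by rewrite (residue_numerator q bezout division).
Qed.
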